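(* Consider the one-dimensional parallel Schwarz method with Robin transmission conditions with $\alpha=ik$ (classical impedance conditions), and suppose that $\sigma=\sigma_0k$ for some constant $\sigma_0>0$. Consider a $k$-dependent domain decomposition given by $L=L_0k^{-1}$ and $\delta=\delta_0k^{-1}$ with constants $L_0,\delta_0>0$ (the subdomain size and overlap shrink inversely proportionally to the wave number $k>0$). Then the convergence of the corresponding Schwarz method (as governed by the spectral radius $\rho(\mathcal{T}_{1d})$ of its iteration matrix) is independent of the wave number $k$. Thus the approach is $k$-robust and the convergence will ultimately be independent of the number of subdomains, i.e. $R_{1d}:=\lim_{N\to\infty}\rho(\mathcal{T}_{1d})$ does not depend on $k$ and $R_{1d}<1$.
   Context: One-dimensional problem: on $\Omega=(a_1,b_N)$, $\mathcal{L}u:=-\partial_{xx}u+(ik\sigma-k^2)u=0$, with $\mathcal{B}_lu:=-\partial_xu+\alpha u=g_1$ at $x=a_1$ and $\mathcal{B}_ru:=\partial_xu+\alpha u=g_2$ at $x=b_N$. The domain is decomposed as $\Omega=\bigcup_{j=1}^N\Omega_j$, $\Omega_j=(a_j,b_j)$, with $b_j-a_j=L+2\delta$, $b_{j-1}-a_j=2\delta$, $a_{j+1}-a_j=b_{j+1}-b_j=L$. The parallel Schwarz method computes $u_j^n$ from $\mathcal{L}u_j^n=0$ in $\Omega_j$, $\mathcal{B}_lu_j^n=\mathcal{B}_lu_{j-1}^{n-1}$ at $a_j$ (replaced by $\mathcal{B}_lu_1^n=g_1$ if $j=1$), $\mathcal{B}_ru_j^n=\mathcal{B}_ru_{j+1}^{n-1}$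 at $b_j$ (replaced by $\mathcal{B}_ru_N^n=g_2$ if $j=N$). The errors' Robin interface data evolve by the stationary iteration with iteration matrix $\mathcal{T}_{1d}\in\mathbb{C}^{2(N-1)\times2(N-1)}$, the block tridiagonal block Toeplitz matrix with $2\times2$ blocks: diagonal blocks $A_0=\begin{bmatrix}0&b\\ b&0\end{bmatrix}$, first superdiagonal blocks $A_1=\begin{bmatrix}a&0\\0&0\end{bmatrix}$, first subdiagonal blocks $A_{-1}=\begin{bmatrix}0&0\\0&a\end{bmatrix}$, where $$a=\frac{(\zeta+\alpha)^2e^{2\zeta\delta}-(\zeta-\alpha)^2e^{-2\zeta\delta}}{(\zeta+\alpha)^2e^{\zeta(2\delta+L)}-(\zeta-\alpha)^2e^{-\zeta(2\delta+L)}},\qquad b=-\frac{(\zeta^2-\alpha^2)(e^{\zeta L}-e^{-\zeta L})}{(\zeta+\alpha)^2e^{\zeta(2\delta+L)}-(\zeta-\alpha)^2e^{-\zeta(2\delta+L)}},$$ and $\zeta=\sqrt{ik\sigma-k^2}$ (principal square root). $\rho$ denotes the spectral radius. *)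

(* Defs.v *)
From HB Require Import structures.
From mathcomp Require Import all_boot all_order all_algebra.
From mathcomp Require Export complex.
From mathcomp Require Import all_classical all_reals all_analysis.

Set Implicit Arguments.
Unset Strict Implicit.
Unset Printing Implicit Defensive.

Import Order.TTheory GRing.Theory Num.Theory.
Import numFieldNormedType.Exports.

Local Open Scope classical_set_scope.
Local Open Scope ring_scope.
Local Open Scope complex_scope.

Definition expC (R : realType) (z : R[i]) : R[i] :=
  let: x +i* y := z in (expR x * cos y) +i* (expR x * sin y).

(* For n = 0 there are no eigenvalues and the value is sup set0 = 0. *)
Definition spectral_radius (R : realType) (n : nat) (A : 'M[R[i]]_n) : R :=
  sup [set Normc.normc lambda | lambda in [set mu | eigenvalue A mu]].

(* [sqrtc] is the principal branch: nonnegative real part, cut along the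
   negative real axis. *)
Definition zeta (R : realType) (k sigma : R) : R[i] :=
  sqrtc ('i%C * (k * sigma)%:C - (k ^+ 2)%:C).

Definition schwarz_den (R : realType) (z alpha : R[i]) (L delta : R) : R[i] :=
  (z + alpha) ^+ 2 * expC (z * (2 * delta + L)%:C)
  - (z - alpha) ^+ 2 * expC (- z * (2 * delta + L)%:C).

Definition schwarz_a (R : realType) (z alpha : R[i]) (L delta : R) : R[i] :=
  ((z + alpha) ^+ 2 * expC (2 * z * delta%:C)
   - (z - alpha) ^+ 2 * expC (- 2 * z * delta%:C))
  / schwarz_den z alpha L delta.

Definition schwarz_b (R : realType) (z alpha : R[i]) (L delta : R) : R[i] :=
  - ((z ^+ 2 - alpha ^+ 2) * (expC (z * L%:C) - expC (- z * L%:C))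
     / schwarz_den z alpha L delta).

Definition toeplitz_block (R : realType) (a b : R[i]) (i j : nat) : 'M[R[i]]_2 :=
  if j == i then b *: (delta_mx 0 1 + delta_mx 1 0)
  else if j == i.+1 then a *: delta_mx 0 0
  else if i == j.+1 then a *: delta_mx 1 1
  else 0.

(* N is the number of subdomains, so there are N - 1 block rows. *)
Definition T1d (R : realType) (N : nat) (k sigma : R) (alpha : R[i])
    (L delta : R) : 'M[R[i]]_(\sum_(i < N.-1) 2) :=
  let a := schwarz_a (zeta k sigma) alpha L delta in
  let b := schwarz_b (zeta k sigma) alpha L delta in
  \mxblock_(i < N.-1, j < N.-1) toeplitz_block a b i j.

Definition rho_T1d (R : realType) (k sigma : R) (alpha : R[i]) (L delta : R)
    (N : nat) : R :=
  spectral_radius (T1d N k sigma alpha L delta).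

(* [limn] is only meaningful when the sequence converges. *)
Definition R1d (R : realType) (k sigma : R) (alpha : R[i]) (L delta : R) : R :=
  limn (rho_T1d k sigma alpha L delta).

(* Main.v *)
Require Import Defs.
From HB Require Import structures.
From mathcomp Require Import all_boot all_order all_algebra.
From mathcomp Require Import complex.
From mathcomp Require Import all_classical all_reals all_analysis.
From mathcomp Require Import ring lra zify.
Set Implicit Arguments.
Unset Strict Implicit.
Unset Printing Implicit Defensive.

Import Order.TTheory GRing.Theory Num.Theory.
Import numFieldNormedType.Exports.

Local Open Scope classical_set_scope.
Local Open Scope ring_scope.
Local Open Scope complex_scope.

(** Everything happens on the pair of coefficients a, b.  With alpha = i k,
    sigma = sigma0 k, L = L0 / k and delta = delta0 / k one has
    zeta = k (x + i y) for a point x + i y of the open first quadrant that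
    depends on sigma0 only.  The exponents zeta L and zeta delta are then free
    of k, and the factors k^2 of the numerators and denominators cancel
    (schwarz_scaling): a and b, hence the whole iteration matrix, do not depend
    on k.

    The remaining content is that the spectral radius for n block rows tends to
    r = max(|a + b|, |a - b|) as n grows, and that r < 1.

    Upper bound.  An eigenvector is a solution of a first-order system which,
    after shifting one of its two components by one block, applies the matrix
    [[b, a], [a, b]] to each pair of neighbouring entries.  That matrix is
    normal with eigenvalues b + a and b - a, so its norm is r, and summing over
    the blocks bounds every eigenvalue by r, for every n
    (interface_eigenvalue_le).

    Lower bound.  Shooting from one end of the system gives polynomials D_n of
    degree 2n whose nonzero roots are eigenvalues (interface_system_poly).  At
    l = a + b the transfer matrix has a double eigenvalue, so D_n(l) and D_n'(l)
    are explicit (interface_poly_double_point): up to a common factor they grow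
    like nonzero multiples of n and of n^3.  Since D'/D is the sum of the
    1 / (X - root), some root lies within deg(D) |D / D'|, which is O(1 / n), of l
    (root_near).  Replacing b by -b does not change the spectrum, so a - b is
    approached as well, and the one of larger modulus is not 0.

    Contraction.  With P = zeta + alpha, M = zeta - alpha, d = e^(2 zeta delta)
    and l = e^(zeta L), both coefficients share a factor:
    a + b = (P d - M l) / (P d l - M) and a - b = (P d + M l) / (P d l + M).
    The difference of the squared moduli of denominator and numerator is
    (|l|^2 - 1)(|P d|^2 - |M|^2) plus or minus 4 Im l Im (P d conj M); its
    positivity (robin_lt) reduces to sinh u > u for u > 0 and |sin t| <= t for
    t >= 0. *)

(** * Locating a root from a logarithmic derivative *)

(** The logarithmic derivative of the product is the sum of the 1 / (x - r),
    each of which is smaller than 1 / e; here without dividing. *)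
Lemma deriv_prod_XsubC_le (F : numFieldType) (s : seq F) (x e : F) :
    0 < e -> {in s, forall r, e < `|x - r|} ->
  e * `|(\prod_(r <- s) ('X - r%:P))^`().[x]| <=
    (size s)%:R * `|(\prod_(r <- s) ('X - r%:P)).[x]|.
Proof.
move=> e_gt0; elim: s => [|r s IHs] far.
  by rewrite big_nil derivC horner0 normr0 mulr0 mul0r.
have far_s : {in s, forall r, e < `|x - r|}.
  by move=> t ts; apply: far; rewrite in_cons ts orbT.
have far_r : e <= `|x - r| by apply/ltW/far; rewrite mem_head.
rewrite big_cons derivM derivXsubC hornerD !hornerM hornerC hornerXsubC mul1r
  normrM.
set Q := \prod_(_ <- s) _ in IHs *; rewrite /= -natr1 (mulrDl _%:R) mul1r.
apply: le_trans (ler_wpM2l (ltW e_gt0) (ler_normD _ _)) _.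
rewrite mulrDr normrM addrC lerD //; last by rewrite ler_wpM2r.
by rewrite mulrCA [leRHS]mulrCA ler_wpM2l ?normr_ge0 // IHs.
Qed.

(** A root-existence principle that needs no topology: a large logarithmic
    derivative at x forces a root close to x. *)
Lemma root_near (F : numClosedFieldType) (p : {poly F}) (x e : F) :
    0 < e -> (size p).-1%:R * `|p.[x]| < e * `|p^`().[x]| ->
  exists2 r, root p r & `|x - r| <= e.
Proof.
move=> e_gt0 small.
have p_neq0 : p != 0.
  by apply: contraTneq small => ->; rewrite derivC !horner0 normr0 !mulr0 ltxx.
have [s def_p] := closed_field_poly_normal p.
have size_p : (size p).-1 = size s.
  by rewrite def_p size_scale ?lead_coef_eq0 // size_prod_XsubC.
have [/hasP[r rs near_r]|/hasPn far] := boolP (has (fun r => `|x - r| <= e) s).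
  by exists r; rewrite // def_p rootZ ?lead_coef_eq0 // root_prod_XsubC.
move: small; rewrite size_p def_p derivZ !hornerZ !normrM
  !(mulrCA _ `|lead_coef _|).
rewrite ltr_pM2l ?normr_gt0 ?lead_coef_eq0 // => small.
suff /(lt_le_trans small) : e * `|(\prod_(r <- s) ('X - r%:P))^`().[x]| <=
    (size s)%:R * `|(\prod_(r <- s) ('X - r%:P)).[x]| by rewrite ltxx.
apply: deriv_prod_XsubC_le => // r /far.
by rewrite real_ltNge ?normr_real ?gtr0_real.
Qed.

(** * The characteristic polynomials of the interface system *)

(** Solving the interface system upwards multiplies (x_j, y_j) by a transfer
    matrix; multiplying that matrix by a l, where l is the eigenvalue, removes
    its denominators.  This is the orbit of (1, 0) under the result, the
    indeterminate standing for l. *)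
Fixpoint interface_poly (F : comNzRingType) (a b : F) (n : nat) :
    {poly F} * {poly F} :=
  if n is m.+1 then
    let: (D, Y) := interface_poly a b m in
    (('X^2 - (b ^+ 2)%:P) * D - (a * b) *: Y, (a * b) *: D + a ^+ 2 *: Y)
  else (1, 0).

Lemma size_interface_poly (F : comNzRingType) (a b : F) n :
  (size (interface_poly a b n).1 <= n.*2.+1)%N /\
  (size (interface_poly a b n).2 <= n.*2.+1)%N.
Proof.
elim: n => [|n] /=; first by rewrite size_poly1 size_poly0.
case: (interface_poly a b n) => [D Y] /= [sD sY].
have sZ c (p : {poly F}) : (size p <= n.*2.+1 -> size (c *: p)%R <= n.*2.+3)%N.
  move=> sp; apply: leq_trans (size_scale_leq _ _) (leq_trans sp _).
  by rewrite -addn2 leq_addr.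
have sD2 : (size (('X^2 - (b ^+ 2)%:P) * D)%R <= n.*2.+3)%N.
  by apply: leq_trans (size_polyMleq _ _) _; rewrite size_XnsubC.
rewrite doubleS; split; rewrite (leq_trans (size_polyD _ _)) // geq_max.
  by rewrite sD2 size_polyN sZ.
by rewrite !sZ.
Qed.

(** At l = a + b the matrix of the recursion is q plus a nilpotent matrix, so
    its powers are affine in n up to the factor q^n.  The derivatives solve
    the same recursion with a forcing term that is affine in n, hence are
    cubic in n: with p = l^2 + a^2 - b^2 and w the sequence defined by
    w_(-1) = 0, w_0 = 1 and w_(n+1) = p w_n - (a l)^2 w_(n-1), one has
    D_n = w_n - a^2 w_(n-1) and Y_n = a b w_(n-1), and q^(n-1) v(n) is the
    derivative of w_n at l = a + b.  The factors q and l on the left avoid the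
    exponents n - 1 and n - 2. *)
Lemma interface_poly_double_point (F : numFieldType) (a b : F) (n : nat) :
    let l := a + b in let q := a * l in l != 0 -> a != 0 ->
    let v (m : F) := l * m * (m + 1) + b * (m ^+ 3 - m) / 3 in
  let: (D, Y) := interface_poly a b n in
  [/\ q * D.[l] = q ^+ n * (q + n%:R * (a * b)),
      q * Y.[l] = q ^+ n * (n%:R * (a * b)),
      q * l * D^`().[l] = q ^+ n * (l * v n%:R - a * v (n%:R - 1))
    & q * l * Y^`().[l] = q ^+ n * (b * v (n%:R - 1))].
Proof.
move=> l q l_neq0 a_neq0 v.
elim: n => [|n] /=.
  rewrite derivC !hornerE /v mulr0n; split; try ring.
  by rewrite deriv0 horner0; field.
case: (interface_poly a b n) => [D Y] [eD eY ed ey].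
have q_neq0 : q != 0 by rewrite mulf_neq0.
have eD' : D.[l] = q ^+ n * (q + n%:R * (a * b)) / q by rewrite -eD mulrC mulKf.
have eY' : Y.[l] = q ^+ n * (n%:R * (a * b)) / q by rewrite -eY mulrC mulKf.
have ql0 : q * l != 0 by rewrite mulf_neq0.
have ed' : D^`().[l] = q ^+ n * (l * v n%:R - a * v (n%:R - 1)) / (q * l).
  by rewrite -ed mulrC mulKf.
have ey' : Y^`().[l] = q ^+ n * (b * v (n%:R - 1)) / (q * l).
  by rewrite -ey mulrC mulKf.
rewrite !(derivB, derivD, derivM, derivZ, derivXn, derivC) !hornerE /=.
rewrite eD' eY' ed' ey' -natr1 (exprS q n).
have -> : q = a * (a + b) by [].
have l_neq0' : a + b != 0 by [].
rewrite /v /l.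
move: (_ ^+ n) => E; split; field; rewrite ?l_neq0' ?a_neq0 //.
Qed.

(** * Eigenvectors as solutions of the interface system *)

(** A row eigenvector for l has blocks (y_(j+1), x_j).  Shifting y makes the
    two equations of step j relate (x_j, y_j) and (x_(j+1), y_(j+1)); the values
    y_0 = 0 and x_n = 0 stand for the neighbours missing at both ends. *)
Definition interface_system (F : fieldType) (a b l : F) (n : nat)
    (x y : nat -> F) :=
  [/\ y 0 = 0, x n = 0 & forall j, (j < n)%N ->
     l * y j.+1 = b * x j + a * y j /\ l * x j = b * y j.+1 + a * x j.+1].

Lemma parallelogram (F : numClosedFieldType) (x y : F) :
  `|x + y| ^+ 2 + `|x - y| ^+ 2 = 2 * (`|x| ^+ 2 + `|y| ^+ 2).
Proof. by rewrite !normCK !rmorphD !rmorphN /=; ring. Qed.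

(** [[b, a], [a, b]] is diagonal in the orthogonal basis (1, 1), (1, -1), with
    eigenvalues b + a and b - a. *)
Lemma exchange_norm_le (F : numClosedFieldType) (a b r x y : F) :
    `|a + b| <= r -> `|a - b| <= r ->
  `|b * x + a * y| ^+ 2 + `|b * y + a * x| ^+ 2 <= r ^+ 2 * (`|x| ^+ 2 + `|y| ^+ 2).
Proof.
move=> le_p le_m.
have r_ge0 : 0 <= r := le_trans (normr_ge0 _) le_p.
rewrite -(ler_pM2l (ltr0n F 2)) -parallelogram mulrCA -parallelogram mulrDr.
rewrite (_ : _ + _ + _ = (a + b) * (x + y)); last by ring.
rewrite (_ : _ - _ = (b - a) * (x - y)); last by ring.
by rewrite !normrM !exprMn distrC lerD // ler_wpM2r ?exprn_ge0 // lerXn2r ?nnegrE.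
Qed.

(** Summing the squared equations and regrouping the terms by the neighbours
    x_j, y_j turns the right-hand side into copies of the 2 x 2 matrix of the
    previous lemma; the boundary values make both sums of squares equal. *)
Lemma interface_eigenvalue_le (F : numClosedFieldType) (a b l r : F) n
      (x y : nat -> F) :
    `|a + b| <= r -> `|a - b| <= r -> interface_system a b l n x y ->
    (exists2 j, (j < n)%N & (x j != 0) || (y j.+1 != 0)) -> `|l| <= r.
Proof.
move=> le_p le_m [y0 xn sys] [j0 lt_j0 nz].
have r_ge0 : 0 <= r := le_trans (normr_ge0 _) le_p.
pose S := \sum_(j < n) (`|x j| ^+ 2 + `|y j.+1| ^+ 2).
have S_gt0 : 0 < S.
  have ge0 j : 0 <= `|x j| ^+ 2 + `|y j.+1| ^+ 2 by rewrite addr_ge0 ?exprn_ge0.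
  rewrite /S (bigD1 (Ordinal lt_j0)) //= ltr_pwDl ?sumr_ge0 //.
  rewrite lt_def ge0 paddr_eq0 ?exprn_ge0 // !expf_eq0 !normr_eq0 /=.
  by rewrite andbT negb_and.
have shiftS : S = \sum_(j < n.+1) (`|x j| ^+ 2 + `|y j| ^+ 2).
  rewrite /S !big_split /=; congr (_ + _).
    by rewrite big_ord_recr /= xn normr0 expr0n addr0.
  by rewrite [RHS]big_ord_recl /= y0 normr0 expr0n add0r.
suff le_S : `|l| ^+ 2 * S <= r ^+ 2 * S.
  by rewrite -(ler_pXn2r (_ : 0 < 2)%N) ?nnegrE // -(ler_pM2r S_gt0).
have -> : `|l| ^+ 2 * S =
    \sum_(j < n) (`|b * x j + a * y j| ^+ 2 + `|b * y j.+1 + a * x j.+1| ^+ 2).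
  rewrite mulr_sumr; apply: eq_bigr => j _; have [<- <-] := sys j (ltn_ord j).
  by rewrite mulrDr !normrM !exprMn addrC.
(* The two boundary terms missing on the left are nonnegative. *)
apply: (@le_trans _ _ (\sum_(j < n.+1)
  (`|b * x j + a * y j| ^+ 2 + `|b * y j + a * x j| ^+ 2))).
  rewrite !big_split /= lerD //.
    by rewrite [leRHS]big_ord_recr /= lerDl exprn_ge0.
  by rewrite [leRHS]big_ord_recl /= lerDr exprn_ge0.
rewrite shiftS mulr_sumr; apply: ler_sum => j _; exact: exchange_norm_le.
Qed.

(** At a root of D_n the shooting solution started from x_0 = 1, y_0 = 0 meets
    the boundary condition x_n = 0. *)
Lemma interface_system_poly (F : fieldType) (a b l : F) n :
    a != 0 -> l != 0 -> root (interface_poly a b n).1 l ->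
  interface_system a b l n
    (fun j => (interface_poly a b j).1.[l] / (a * l) ^+ j)
    (fun j => (interface_poly a b j).2.[l] / (a * l) ^+ j).
Proof.
move=> a_neq0 l_neq0 /rootP rootD; split=> [||j _] /=.
- by rewrite horner0 mul0r.
- by rewrite rootD mul0r.
case: (interface_poly a b j) => [D Y] /=.
rewrite !(hornerXn, hornerD, hornerN, hornerM, hornerZ, hornerC) (exprS _ j).
have : (a * l) ^+ j != 0 by rewrite expf_neq0 ?mulf_neq0.
by move: (_ ^+ j) => E E_neq0; split; field; rewrite E_neq0 l_neq0.
Qed.

Lemma sum_ord_if_eq (V : nmodType) (F : nat -> V) m n :
  \sum_(i < n) (if i == m :> nat then F i else 0) = if (m < n)%N then F m else 0.
Proof. by rewrite -big_mkcond big_ord1_eq. Qed.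

Definition interface_row (F : fieldType) n (x y : nat -> F) :
    'rV[F]_(\sum_(i < n) 2) :=
  \mxrow_(i < n) \row_(k < 2) (if k == 0 then y i.+1 else x i).

Lemma interface_row_mulmx (R : realType) (a b : R[i]) n (x y : nat -> R[i]) :
    y 0 = 0 -> x n = 0 ->
  interface_row n x y *m (\mxblock_(i < n, j < n) toeplitz_block a b i j) =
  interface_row n (fun j => b * y j.+1 + a * x j.+1)
    (fun j => b * x j.-1 + a * y j.-1).
Proof.
move=> y0 xn; rewrite mul_mxrow_mxblock; apply: eq_mxrow => j.
apply/rowP => k; rewrite summxE mxE /=.
(* Only the blocks i = j, j = i + 1 and i = j + 1 contribute. *)
transitivity (\sum_(i < n) (if i == j :> nat then b *
  (if k == 0 then x i else y i.+1) else 0)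
  + (\sum_(i < n) (if j == i.+1 :> nat then a *
    (if k == 0 then y i.+1 else 0) else 0)
  + \sum_(i < n) (if i == j.+1 :> nat then a *
    (if k == 0 then 0 else x i) else 0))).
{ rewrite -!big_split /=; apply: eq_bigr => i _;
  rewrite mxE big_ord_recl big_ord1 !mxE /=.
  rewrite /toeplitz_block; case: k => [[|[|//]] k2] /=; case: (ltngtP i j) => ij.
  all: case: (eqVneq (j : nat) i.+1) => [e1|_];
    case: (eqVneq (i : nat) j.+1) => [e2|_].
  all: try (exfalso; lia).
  all: rewrite !mxE /=; ring. }
rewrite (sum_ord_if_eq (fun i => b * (if k == 0 then x i else y i.+1))) ltn_ord.
rewrite (sum_ord_if_eq (fun i => a * (if k == 0 then 0 else x i))).
have -> : (if (j.+1 < n)%N then a * (if k == 0 then 0 else x j.+1) else 0) =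
    (if k == 0 then 0 else a * x j.+1).
  case: (k == 0); first by rewrite mulr0 if_same.
  have [//|le_nj] := ltnP j.+1 n.
  by rewrite (_ : j.+1 = n) ?xn ?mulr0 //; apply/eqP; rewrite eqn_leq ltn_ord.
have -> : \sum_(i < n) (if j == i.+1 :> nat then a *
  (if k == 0 then y i.+1 else 0) else 0) =
    (if k == 0 then a * y j else 0).
  case: (j : nat) (ltn_ord j) => [|m] lt_mn.
    by rewrite big1 // y0 mulr0 if_same.
  under eq_bigr => i _ do rewrite eqSS eq_sym.
  rewrite (sum_ord_if_eq (fun i => a *
    (if k == 0 then y i.+1 else 0))) (ltnW lt_mn).
  by case: (k == 0); rewrite ?mulr0.
by case: (k == 0); rewrite ?addr0 ?add0r.
Qed.

(** Both the upper and the lower bound on the spectrum go through this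
    description, which trades block matrices for recurrences. *)
Lemma toeplitz_eigenvalueP (R : realType) (a b l : R[i]) (n : nat) :
  eigenvalue (\mxblock_(i < n, j < n) toeplitz_block a b i j) l <->
  exists x y, interface_system a b l n x y /\
    exists2 j, (j < n)%N & (x j != 0) || (y j.+1 != 0).
Proof.
have scale_row x y : l *: interface_row n x y =
    interface_row n (fun j => l * x j) (fun j => l * y j).
  by apply/rowP => k; rewrite !mxE; case: ifP.
have row_entries x y (j : 'I_n) :
    (submxrow (interface_row n x y) j 0 0 = y j.+1) *
    (submxrow (interface_row n x y) j 0 1 = x j :> R[i]).
  by rewrite mxrowK !mxE.
split=> [/eigenvalueP[v eigv v_neq0]|[x [y [[y0 xn sys] [j lt_j nz]]]]].
  (* Past the last block the default value of oapp gives x_n = 0. *)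
  pose x j := oapp (fun i : 'I_n => submxrow v i 0 1) 0 (insub j).
  pose y j := if j is m.+1 then oapp (fun i : 'I_n => submxrow v i 0 0) 0 (insub m)
    else 0.
  have def_v : v = interface_row n x y.
    rewrite -[LHS]submxrowK; apply: eq_mxrow => i; apply/rowP => k.
    rewrite !mxE /x /= valK /= !mxE; case: k => [[|[|//]] k2] /=;
      congr (v _ (tagnat.Rank _ _)); exact: val_inj.
  have y0 : y 0 = 0 by [].
  have xn : x n = 0 by rewrite /x insubF ?ltnn.
  exists x, y; split.
    split=> // j lt_j; have := eigv.
    rewrite def_v interface_row_mulmx // scale_row => eqv.
    have := row_entries (fun j => b * y j.+1 + a * x j.+1)
      (fun j => b * x j.-1 + a * y j.-1) (Ordinal lt_j).
    by rewrite eqv !row_entries /= => -[-> ->].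
  have [/existsP[j nz]|/existsPn allz] :=
    boolP [exists j : 'I_n, (x j != 0) || (y j.+1 != 0)].
    by exists j.
  case/eqP: v_neq0; rewrite def_v; apply/rowP => k; rewrite !mxE.
  have := allz (tagnat.sig1 k); rewrite negb_or !negbK => /andP[/eqP-> /eqP->].
  by rewrite if_same.
apply/eigenvalueP; exists (interface_row n x y).
  rewrite interface_row_mulmx // scale_row; apply: eq_mxrow => i.
  apply/rowP => k; rewrite !mxE; have [e1 e2] := sys i (ltn_ord i).
  by case: ifP.
apply: contraTneq nz => row0; have := row_entries x y (Ordinal lt_j).
by rewrite row0 submxrow0 !mxE => -[<- <-]; rewrite eqxx.
Qed.

(** * Convergence of the spectral radius *)

(** Up to a common factor, D_n(l) is of order n while D_n'(l) is a multiple of a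
    cubic in n whose leading coefficient b^2 / 3 does not vanish; times the
    degree 2n, their ratio is O(1 / n).  The bound K collects the lower-order
    terms. *)
Lemma root_near_double_point (F : numClosedFieldType) (a b e : F) :
    a != 0 -> b != 0 -> a + b != 0 -> 0 < e ->
  exists2 K : F, 0 <= K & forall n, K < n%:R ->
    exists2 r, root (interface_poly a b n).1 r & `|a + b - r| <= e.
Proof.
move=> a_neq0 b_neq0 l_neq0 e_gt0; pose l := a + b; pose q := a * l.
pose k1 := l ^+ 2 - a * l + a * b.
pose k2 := l ^+ 2 + a * l - b * l / 3 - 2 * a * b / 3.
pose M1 := 2 * `|l| * (`|q| + `|a * b|); pose M2 := `|k1| + `|k2|.
have M1_ge0 : 0 <= M1 by rewrite !mulr_ge0 ?addr_ge0 ?normr_ge0.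
have M2_ge0 : 0 <= M2 by rewrite addr_ge0.
have b2_gt0 : 0 < `|b| ^+ 2 by rewrite exprn_gt0 ?normr_gt0.
exists (3 * (M1 / e + M2) / `|b| ^+ 2) => [|n].
  by rewrite divr_ge0 ?mulr_ge0 ?addr_ge0 ?divr_ge0 // ltW.
rewrite ltr_pdivrMr // => n_large.
have n_gt0 : 0 < n%:R :> F.
  rewrite -(pmulr_lgt0 _ b2_gt0); apply: le_lt_trans n_large.
  by rewrite mulr_ge0 ?addr_ge0 ?divr_ge0 // ltW.
have n_ge1 : 1 <= n%:R :> F by rewrite ler1n -(ltr0n F).
apply: root_near => //.
have := size_interface_poly a b n;
  have := interface_poly_double_point n l_neq0 a_neq0.
case: (interface_poly a b n) => [D Y] [eD _ ed _] [/= sD _].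
rewrite -/l -/q in eD ed *.
have q_neq0 : q != 0 by rewrite mulf_neq0.
apply: (@le_lt_trans _ _ (2 * n%:R * `|D.[l]|)).
  rewrite ler_wpM2r // -natrM ler_nat mul2n.
  by case: (size D) sD.
rewrite -(ltr_pM2l (_ : 0 < `|q * l|)) ?normr_gt0 ?mulf_neq0 //.
rewrite [ltRHS]mulrCA -normrM ed.
rewrite (_ : `|q * l| * _ = 2 * `|l| * n%:R * `|q * D.[l]|); last first.
  by rewrite !normrM; ring.
rewrite eD.
rewrite (_ : l * _ - a * _ = n%:R * (b ^+ 2 / 3 * n%:R ^+ 2 + n%:R * k1 + k2));
  last first.
  by rewrite /k1 /k2 /q /l; field.
rewrite !normrM normrX (ger0_norm (ltW n_gt0)).
rewrite (_ : 2 * _ * _ * _ =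
  (`|q| ^+ n * n%:R) * (2 * `|l| * `|q + n%:R * (a * b)|)); last by ring.
rewrite (_ : e * _ =
  (`|q| ^+ n * n%:R) * (e * `|b ^+ 2 / 3 * n%:R ^+ 2 + n%:R * k1 + k2|));
    last by ring.
(* The common factor cancels; a linear bound M1 n faces a quadratic one. *)
rewrite ltr_pM2l ?mulr_gt0 ?exprn_gt0 ?normr_gt0 //.
apply: (@le_lt_trans _ _ (M1 * n%:R)).
  rewrite /M1 -[leRHS]mulrA ler_wpM2l ?mulr_ge0 //.
  rewrite (le_trans (ler_normD _ _)) // mulrDl lerD //; first by rewrite ler_peMr.
  by rewrite normrM ger0_norm ?(ltW n_gt0) // mulrC.
apply: (@lt_le_trans _ _ (e * (`|b| ^+ 2 / 3 * n%:R ^+ 2 - M2 * n%:R))).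
  rewrite [ltRHS](_ : _ = e * (n%:R * `|b| ^+ 2 / 3 - M2) * n%:R); last by ring.
  rewrite ltr_pM2r // -ltr_pdivrMl // ltrBrDr ltr_pdivlMr ?ltr0n //.
  by rewrite mulrC [_^-1 * _]mulrC.
rewrite ler_wpM2l ?(ltW e_gt0) // lerBlDr.
apply: (@le_trans _ _
  (`|b ^+ 2 / 3 * n%:R ^+ 2 + n%:R * k1 + k2| + `|n%:R * k1 + k2|)).
  rewrite -addrA -lerBlDr; apply: le_trans (lerB_normD _ _).
  by rewrite !(normrX, normrM) normfV !normr_nat.
rewrite lerD2l (le_trans (ler_normD _ _)) // mulrDl lerD //.
  by rewrite normrM ger0_norm ?(ltW n_gt0) // mulrC.
by rewrite ler_peMr.
Qed.

Lemma normc_normr (R : rcfType) (z : R[i]) : `|z| = (Normc.normc z)%:C.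
Proof. by []. Qed.

(** Conjugating by the signs (1, -1) in every block exchanges b and -b; this
    transfers the results on a + b to a - b. *)
Lemma interface_systemN (F : fieldType) (a b l : F) n x y :
  interface_system a b l n x y -> interface_system a (- b) l n x (fun j => - y j).
Proof.
move=> [y0 xn sys]; split=> [||j lt_j]; rewrite ?y0 ?oppr0 //.
by have [e1 e2] := sys j lt_j; split; rewrite ?mulrN ?e1 ?e2; ring.
Qed.

Lemma toeplitz_eigenvalueN (R : realType) (a b l : R[i]) n :
  eigenvalue (\mxblock_(i < n, j < n) toeplitz_block a b i j) l ->
  eigenvalue (\mxblock_(i < n, j < n) toeplitz_block a (- b) i j) l.
Proof.
move=> /toeplitz_eigenvalueP[x [y [sys [j lt_j nz]]]].
apply/toeplitz_eigenvalueP; exists x, (fun j => - y j).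
by split; [exact: interface_systemN | exists j; rewrite ?oppr_eq0].
Qed.

Lemma nat_gt_complex (R : realType) (K : R[i]) :
  exists m : nat, forall n, (m <= n)%N -> `|K| < n%:R.
Proof.
exists (Num.truncn (Normc.normc K)).+1 => n le_mn.
rewrite normc_normr -(rmorph_nat (real_complex R)) ltcR.
apply: lt_le_trans (truncnS_gt _) _; by rewrite ler_nat.
Qed.

(** The root found near a + b is used as an eigenvalue, so it must not be 0;
    hence the radius capped at half the modulus of a + b. *)
Lemma toeplitz_eigenvalue_near (R : realType) (a b : R[i]) (e : R) :
    a != 0 -> b != 0 -> a + b != 0 -> 0 < e ->
  exists m : nat, forall n, (m <= n)%N ->
    exists2 l, eigenvalue (\mxblock_(i < n, j < n) toeplitz_block a b i j) l
      & Normc.normc (a + b) - e <= Normc.normc l.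
Proof.
move=> a_neq0 b_neq0 ab_neq0 e_gt0.
pose e' := Num.min e (Normc.normc (a + b) / 2).
have nab_gt0 : 0 < Normc.normc (a + b) by rewrite -ltcR -normc_normr normr_gt0.
have e'_gt0 : 0 < e'%:C :> R[i] by rewrite ltcR lt_min e_gt0 divr_gt0.
have [K K_ge0 nearK] := root_near_double_point a_neq0 b_neq0 ab_neq0 e'_gt0.
have [m largeK] := nat_gt_complex K.
exists m.+1 => n lt_mn.
have [|l root_l near_l] := nearK n.
  by rewrite -(ger0_norm K_ge0); apply/largeK/ltnW.
have le_l : Normc.normc (a + b) - e' <= Normc.normc l.
  rewrite -lecR rmorphB /= -!normc_normr lerBlDl -lerBlDr.
  by apply: le_trans near_l; apply: lerB_dist.
have l_neq0 : l != 0.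
  rewrite -normr_gt0 normc_normr ltcR; apply: lt_le_trans le_l.
  rewrite subr_gt0 gt_min; apply/orP; right.
  by rewrite ltr_pdivrMr // ltr_pMr // ltr1n.
exists l; last by apply: le_trans le_l; rewrite lerB // ge_min lexx.
apply/toeplitz_eigenvalueP; do 2!eexists; split.
  exact: interface_system_poly a_neq0 l_neq0 root_l.
exists 0%N; first exact: leq_ltn_trans lt_mn.
by rewrite /= hornerC expr0 divr1 oner_eq0.
Qed.

(** A supremum of reals behaves as expected only for bounded sets, so the two
    comparisons come together.  The empty spectrum is why 0 <= r is assumed. *)
Lemma spectral_radius_le (R : realType) n (A : 'M[R[i]]_n) (r : R) : 0 <= r ->
    (forall l, eigenvalue A l -> Normc.normc l <= r) ->
  spectral_radius A <= r /\
  forall l, eigenvalue A l -> Normc.normc l <= spectral_radius A.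
Proof.
move=> r_ge0 bound; set E := [set Normc.normc l | l in [set l | eigenvalue A l]].
have ubE : ubound E r by move=> _ [l /= eig <-]; exact: bound.
split=> [|l eig].
  have [E0|/set0P nonempty] := eqVneq E set0.
    by rewrite /spectral_radius -/E E0 sup0.
  exact: ge_sup.
by apply: ub_le_sup; [exists r | exists l].
Qed.

Lemma addr_neq0_of_le (F : numDomainType) (a b : F) :
  a != 0 -> `|a - b| <= `|a + b| -> a + b != 0.
Proof.
move=> a_neq0; apply: contraTneq => ab0; rewrite ab0 normr0 normr_le0 subr_eq0.
apply: contra_neqN a_neq0 => /eqP ab; apply/eqP.
by move/eqP: ab0; rewrite -ab -mulr2n mulrn_eq0.
Qed.

(** The larger of |a + b| and |a - b| is nonzero, so the corresponding point is
    approached by eigenvalues. *)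
Lemma toeplitz_spectral_radius_bounds (R : realType) (a b : R[i]) (e : R) :
    a != 0 -> b != 0 -> 0 < e ->
  exists m : nat, forall n, (m <= n)%N ->
  let r := Num.max (Normc.normc (a + b)) (Normc.normc (a - b)) in
  r - e <= spectral_radius (\mxblock_(i < n, j < n) toeplitz_block a b i j) <= r.
Proof.
move=> a_neq0 b_neq0 e_gt0.
pose r := Num.max (Normc.normc (a + b)) (Normc.normc (a - b)).
have r_ge : `|a + b| <= r%:C /\ `|a - b| <= r%:C.
  by rewrite !normc_normr !lecR !le_max !lexx orbT.
have r_ge0 : 0 <= r by rewrite -ler0c (le_trans _ r_ge.1).
have bound n l :
    eigenvalue (\mxblock_(i < n, j < n) toeplitz_block a b i j) l ->
    Normc.normc l <= r.
  move/toeplitz_eigenvalueP=> [x [y [sys nz]]].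
  rewrite -lecR -normc_normr; exact: interface_eigenvalue_le r_ge.1 r_ge.2 sys nz.
suff [m near_r] : exists m : nat, forall n, (m <= n)%N ->
    exists2 l, eigenvalue (\mxblock_(i < n, j < n) toeplitz_block a b i j) l
      & r - e <= Normc.normc l.
  exists m => n /near_r[l eig le_l] /=;
    have [rho_le rho_ge] := spectral_radius_le r_ge0 (bound n).
  by rewrite rho_le (le_trans le_l) // rho_ge.
rewrite /r; case: leP => [le_pm|/ltW le_mp].
  have nz : a + - b != 0 by rewrite addr_neq0_of_le // opprK !normc_normr lecR.
  have [|m near_m] := toeplitz_eigenvalue_near a_neq0 _ nz e_gt0;
    first by rewrite oppr_eq0.
  by exists m => n /near_m[l /toeplitz_eigenvalueN]; rewrite opprK; exists l.
by apply: toeplitz_eigenvalue_near => //;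
  rewrite addr_neq0_of_le // !normc_normr lecR.
Qed.

(** * Modulus of the coefficients *)

Lemma abs_sin_le (R : realType) (t : R) : 0 <= t -> `|sin t| <= t.
Proof.
move=> t_ge0.
have [|c _] := @MVT_segment R sin cos 0 t t_ge0.
  exact/continuous_subspaceT/continuous_sin.
rewrite sin0 !subr0 => ->; rewrite normrM (ger0_norm t_ge0).
by rewrite ler_piMl // ler_norml cos_geN1 cos_le1.
Qed.

Lemma expR_sub_expRN_gt (R : realType) (u : R) :
  0 < u -> 2 * u < expR u - expR (- u).
Proof.
move=> u_gt0.
have dE (x : R) :
    is_derive x 1 (fun t => expR t - expR (- t)) (expR x + expR (- x)).
  by apply: is_derive_eq; ring.
have [|c] := @MVT R (fun t => expR t - expR (- t))
    (fun t => expR t + expR (- t)) 0 u u_gt0 (fun x _ => dE x).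
  apply: continuous_subspaceT => x; apply: differentiable_continuous.
  by apply/derivable1_diffP; have [] := dE x.
rewrite in_itv /= => /andP[c_gt0 _]; rewrite oppr0 subrr subr0 addr0 => ->.
rewrite ltr_pM2r //.
have e_gt1 : 1 < expR c by rewrite expR_gt1.
rewrite expRN; set w := expR c in e_gt1 *.
have w0 : 0 < w by apply: lt_trans e_gt1.
rewrite -(ltr_pM2r w0) [ltRHS]mulrDl mulVf ?gt_eqF //; nra.
Qed.

(** Dividing by 2 x y e^(x L): sinh (x L) / x > |sin (y L)| / y, because the left
    side exceeds L and the right side does not. *)
Lemma overlap_gain (R : realType) (x y L : R) : 0 < x -> 0 < y -> 0 < L ->
  2 * x * expR (x * L) * `|sin (y * L)| < y * (expR (x * L) ^+ 2 - 1).
Proof.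
move=> x0 y0 L0.
have := expR_sub_expRN_gt (mulr_gt0 x0 L0).
have := abs_sin_le (ltW (mulr_gt0 y0 L0)).
rewrite expRN; have := expR_gt0 (x * L).
set w := expR _; set s := `|_| => w0 le_s lt_w.
have : 2 * (x * L) * w < w ^+ 2 - 1.
  move: lt_w; rewrite -(ltr_pM2r w0) mulrBl mulVf ?gt_eqF //; nra.
have := ler_wpM2l (ltW (mulr_gt0 x0 w0)) le_s; nra.
Qed.

(** Dividing by 2 e^(x h): y sinh (x h) + cosh (x h) dominates 1 + x y h, which
    dominates the modulus of x sin (y h) + cos (y h). *)
Lemma overlap_defect (R : realType) (x y h : R) : 0 < x -> 1 < y -> 0 < h ->
  2 * expR (x * h) * `|x * sin (y * h) + cos (y * h)| <=
    expR (x * h) ^+ 2 * (y + 1) - (y - 1).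
Proof.
move=> x0 y1 h0; have y0 : 0 < y by apply: lt_trans y1.
have xh0 := mulr_gt0 x0 h0.
have := expR_sub_expRN_gt xh0.
have := abs_sin_le (ltW (mulr_gt0 y0 h0)).
rewrite expRN; have := expR_gt0 (x * h).
have := expR_gt1 (x * h); rewrite xh0.
set w := expR _; set s := sin _; set c := cos _ => w1 w0 le_s lt_w.
have lt_w2 : 2 * (x * h) * w < w ^+ 2 - 1.
  move: lt_w; rewrite -(ltr_pM2r w0) mulrBl mulVf ?gt_eqF //; nra.
have le_n : `|x * s + c| <= x * (y * h) + 1.
  apply: le_trans (ler_normD _ _) _; rewrite lerD //.
    by rewrite normrM gtr0_norm // ler_pM2l.
  by rewrite ler_norml cos_geN1 cos_le1.
apply: (@le_trans _ _ (2 * w * (x * (y * h) + 1)));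
  first by rewrite ler_pM2l ?mulr_gt0.
nra.
Qed.

Lemma expCD (R : realType) (z w : R[i]) : expC (z + w) = expC z * expC w.
Proof.
case: z w => [a b] [c d]; rewrite /expC /= expRD cosD sinD; simpc.
congr (_ +i* _); ring.
Qed.

Lemma expC0 (R : realType) : expC (0 : R[i]) = 1.
Proof. by rewrite /expC /= expR0 cos0 sin0 mulr0 mulr1. Qed.

Lemma expC_neq0 (R : realType) (z : R[i]) : expC z != 0.
Proof.
have : expC z * expC (- z) = 1 by rewrite -expCD subrr expC0.
by apply: contra_eqN => /eqP ->; rewrite mul0r eq_sym oner_eq0.
Qed.

Lemma expCN (R : realType) (z : R[i]) : expC (- z) = (expC z)^-1.
Proof.
by apply: (mulfI (expC_neq0 z)); rewrite -expCD subrr expC0 divff ?expC_neq0.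
Qed.

(** The quantity assumed positive is |u l - v|^2 - |u - v l|^2: the cross
    terms combine into -2 Re (u conj(v) (l - conj(l))). *)
Lemma normc_cross_lt (R : rcfType) (u1 u2 v1 v2 l1 l2 : R) :
    let u := u1 +i* u2 in let v := v1 +i* v2 in let l := l1 +i* l2 in
    0 < (l1 ^+ 2 + l2 ^+ 2 - 1) * (u1 ^+ 2 + u2 ^+ 2 - (v1 ^+ 2 + v2 ^+ 2))
        + 4 * l2 * (u2 * v1 - u1 * v2) ->
  Normc.normc (u - v * l) < Normc.normc (u * l - v).
Proof.
move=> u v l pos; rewrite /u /v /l; simpc; rewrite /=.
set A := (X in Num.sqrt X < _); set B := (X in _ < Num.sqrt X).
have lt_AB : A < B.
  by move: pos; rewrite -[A < B]subr_gt0; congr (_ < _); rewrite /A /B; ring.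
by rewrite ltr_sqrt // (le_lt_trans _ lt_AB) // addr_ge0 ?sqr_ge0.
Qed.

(** With t = 1 and t = -1 this bounds the factored forms of a + b and a - b.
    Since y^2 = x^2 + 1, the squared moduli of z + i and z - i are 2 y (y + 1)
    and 2 y (y - 1), and (z + i) conj(z - i) = 2 x (x + i); the claim
    becomes the product of overlap_gain and overlap_defect. *)
Lemma robin_lt (R : realType) (x y L delta t : R) :
    let z := x +i* y in
    let d := expC (2 * z * delta%:C) in let l := expC (z * L%:C) in
    0 < x -> 0 < y -> y ^+ 2 = x ^+ 2 + 1 -> 0 < L -> 0 < delta -> t ^+ 2 = 1 ->
  Normc.normc ((z + 'i%C) * d - t%:C * (z - 'i%C) * l) <
  Normc.normc ((z + 'i%C) * d * l - t%:C * (z - 'i%C)).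
Proof.
move=> z d l x0 y0 yx L0 d0 t2.
have y1 : 1 < y by nra.
have h0 : 0 < 2 * delta by rewrite mulr_gt0.
have := overlap_gain x0 y0 L0; have := overlap_defect x0 y1 h0.
have e1 : d = expR (x * (2 * delta)) * cos (y * (2 * delta)) +i*
    (expR (x * (2 * delta)) * sin (y * (2 * delta))).
  rewrite /d (_ : 2 * z * _ = (x * (2 * delta)) +i* (y * (2 * delta))) //.
  rewrite /z -(rmorph_nat (real_complex R)); simpc; congr (_ +i* _); ring.
have e2 : l = expR (x * L) * cos (y * L) +i* (expR (x * L) * sin (y * L)).
  by rewrite /l (_ : z * _ = (x * L) +i* (y * L)) // /z; simpc.
have D1 : 1 < expR (x * (2 * delta)) by rewrite expR_gt1 mulr_gt0.
have E1 : 1 < expR (x * L) by rewrite expR_gt1 mulr_gt0.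
have := cos2Dsin2 (y * (2 * delta)); have := cos2Dsin2 (y * L).
rewrite e1 e2 /z.
move: (expR (x * (2 * delta))) (expR (x * L)) (cos (y * (2 * delta)))
  (sin (y * (2 * delta))) (cos (y * L)) (sin (y * L)) D1 E1.
move=> D E c s cL sL D1 E1 csL cs le_w lt_s.
have -> : t%:C * (x +i* y - 'i%C) = (t * x) +i* (t * (y - 1)) by simpc.
have -> : (x +i* y + 'i%C) * ((D * c) +i* (D * s)) =
   (D * (x * c - (y + 1) * s)) +i* (D * (x * s + (y + 1) * c)).
  simpc; congr (_ +i* _); ring.
apply: normc_cross_lt.
have -> : (E * cL) ^+ 2 + (E * sL) ^+ 2 = E ^+ 2.
  by rewrite !exprMn -mulrDr csL mulr1.
have -> : (D * (x * c - (y + 1) * s)) ^+ 2 + (D * (x * s + (y + 1) * c)) ^+ 2 =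
  D ^+ 2 * (2 * y * (y + 1)).
  transitivity (D ^+ 2 * (x ^+ 2 + (y + 1) ^+ 2) * (c ^+ 2 + s ^+ 2));
    first by ring.
  by rewrite cs mulr1; congr (_ * _); rewrite -[x ^+ 2](addrK 1) -yx; ring.
have -> : (t * x) ^+ 2 + (t * (y - 1)) ^+ 2 = 2 * y * (y - 1).
  by rewrite !exprMn t2 !mul1r -[x ^+ 2](addrK 1) -yx; ring.
have -> : D * (x * s + (y + 1) * c) * (t * x) -
    D * (x * c - (y + 1) * s) * (t * (y - 1)) = 2 * t * D * x * (x * s + c).
  transitivity (t * D * ((x ^+ 2 + 1 + y ^+ 2 - 2) * s + 2 * x * c)); first by ring.
  by rewrite yx; ring.
set w := x * s + c in le_w *.
have gap_gt0 : 0 < D ^+ 2 * (y + 1) - (y - 1).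
  have D2 : 1 < D ^+ 2 by rewrite exprn_egt1.
  have : 0 < (D ^+ 2 - 1) * (y + 1) by rewrite mulr_gt0; lra.
  lra.
have lt_prod : (2 * x * E * `|sL|) * (2 * D * `|w|) <
  (y * (E ^+ 2 - 1)) * (D ^+ 2 * (y + 1) - (y - 1)).
  apply: le_lt_trans
    (_ : _ <= (2 * x * E * `|sL|) * (D ^+ 2 * (y + 1) - (y - 1))) _.
    by rewrite ler_wpM2l // !mulr_ge0 ?normr_ge0 //; lra.
  by rewrite ltr_pM2r.
have t1 : `|t| = 1.
  by apply/eqP; rewrite -(@eqrXn2 _ 2) // real_normK ?num_real // t2 expr1n.
have := lerNnormlW (lexx `|t * sL * w|).
rewrite !normrM t1 mul1r => ge_m.
rewrite (_ : _ + _ = 2 * ((y * (E ^+ 2 - 1)) * (D ^+ 2 * (y + 1) - (y - 1)) +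
  (4 * x * E * D) * (t * sL * w))); last by ring.
rewrite mulr_gt0 // -ltrBlDr sub0r.
apply: le_lt_trans lt_prod.
rewrite [leRHS](_ : _ = 4 * x * E * D * (`|sL| * `|w|)); last by ring.
rewrite -mulrN ler_wpM2l // ?mulr_ge0 //; lra.
Qed.

(** The denominator is (p d l - m)(p d l + m) / (d l), and the numerator of a + b
    or a - b contains one of these two factors.  The first two forms serve for
    the moduli, the last two for non-vanishing. *)
Lemma schwarz_coefficients_factor (F : fieldType) (p m d l : F) :
    d != 0 -> l != 0 -> p * d * l - m != 0 -> p * d * l + m != 0 ->
  let den := p ^+ 2 * (d * l) - m ^+ 2 / (d * l) in
  let a := (p ^+ 2 * d - m ^+ 2 / d) / den in
  let b := - (p * m * (l - l^-1) / den) in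
  [/\ a + b = (p * d - m * l) / (p * d * l - m),
      a - b = (p * d + m * l) / (p * d * l + m),
      a = (p * d - m) * (p * d + m) * l / ((p * d * l - m) * (p * d * l + m)) &
      b = - (p * m * (l - 1) * (l + 1) * d / ((p * d * l - m) * (p * d * l + m)))].
Proof.
move=> d0 l0 nz1 nz2 den a b.
have den_neq0 : p ^+ 2 * (d * l) * (d * l) - m ^+ 2 != 0.
  by rewrite (_ : _ - _ = (p * d * l - m) * (p * d * l + m)) ?mulf_neq0 //; ring.
by rewrite /b /a /den; split; field; rewrite ?nz1 ?nz2 l0 d0.
Qed.

Lemma normc_expC (R : realType) (z : R[i]) :
  Normc.normc (expC z) = expR (complex.Re z).
Proof.
case: z => x y /=; rewrite !exprMn -mulrDr cos2Dsin2 mulr1 sqrtr_sqr.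
by rewrite ger0_norm ?expR_ge0.
Qed.

(** Non-vanishing matters as well: for b = 0 and a <> 0 the matrix is nilpotent
    and its spectral radius is 0 instead of |a|. *)
Lemma schwarz_coefficients (R : realType) (x y L delta : R) :
    0 < x -> 0 < y -> y ^+ 2 = x ^+ 2 + 1 -> 0 < L -> 0 < delta ->
  let a := schwarz_a (x +i* y) 'i%C L delta in
  let b := schwarz_b (x +i* y) 'i%C L delta in
  [/\ a != 0, b != 0, Normc.normc (a + b) < 1 & Normc.normc (a - b) < 1].
Proof.
move=> x0 y0 yx L0 delta0.
have lt_p := @robin_lt R x y L delta 1 x0 y0 yx L0 delta0 (expr1n _ _).
have lt_m := @robin_lt R x y L delta (- 1) x0 y0 yx L0 delta0
  (etrans (sqrrN 1) (expr1n _ _)).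
move: lt_p lt_m; rewrite /schwarz_a /schwarz_b /schwarz_den; cbv zeta.
set z := x +i* y.
have -> : z ^+ 2 - 'i%C ^+ 2 = (z + 'i%C) * (z - 'i%C) by ring.
have -> : z * (2 * delta + L)%:C = 2 * z * delta%:C + z * L%:C.
  by rewrite rmorphD rmorphM rmorph_nat /=; ring.
have -> : - z * (2 * delta + L)%:C = - (2 * z * delta%:C + z * L%:C).
  by rewrite rmorphD rmorphM rmorph_nat /=; ring.
rewrite !mulNr !expCN expCD.
have normd : 1 < Normc.normc (expC (2 * z * delta%:C)).
  rewrite normc_expC expR_gt1 (_ : 2 * z * delta%:C = (2 * delta)%:C * z).
    by rewrite /z; simpc; rewrite /= !mulr_gt0.
  by rewrite rmorphM rmorph_nat /=; ring.
have norml : 1 < Normc.normc (expC (z * L%:C)).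
  by rewrite normc_expC expR_gt1 /z; simpc; rewrite /= mulr_gt0.
have d_neq0 := expC_neq0 (2 * z * delta%:C).
have l_neq0 := expC_neq0 (z * L%:C).
move: (expC _) (expC (z * _)) normd norml d_neq0 l_neq0 =>
  d l normd norml d_neq0 l_neq0.
have lt_MP : Normc.normc (z - 'i%C) < Normc.normc (z + 'i%C).
  by rewrite /z; simpc; rewrite /= ltr_sqrt; nra.
have M_neq0 : z - 'i%C != 0.
  by rewrite /z; simpc; rewrite eq_complex negb_and /= gt_eqF.
set P := z + 'i%C in lt_MP *; set M := z - 'i%C in lt_MP M_neq0 *.
rewrite rmorph1 rmorphN1 mul1r mulN1r opprK mulNr opprK => lt_p lt_m.
have neq0_of_lt (u v : R[i]) : Normc.normc u < Normc.normc v -> v != 0.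
  apply: contraTneq => ->; rewrite Normc.normc0 -leNgt.
  by rewrite -ler0c -normc_normr normr_ge0.
have nz_p := neq0_of_lt _ _ lt_p; have nz_m := neq0_of_lt _ _ lt_m.
have [-> -> -> ->] := schwarz_coefficients_factor d_neq0 l_neq0 nz_p nz_m.
have P_neq0 := neq0_of_lt _ _ lt_MP.
have normc_ratio_lt (u v : R[i]) :
    Normc.normc u < Normc.normc v -> Normc.normc (u / v) < 1.
  move=> lt_uv; rewrite Normc.normcM Normc.normcV ltr_pdivrMr ?mul1r //.
  by apply: le_lt_trans lt_uv; rewrite -ler0c -normc_normr normr_ge0.
have sub_neq0_of_lt (u v : R[i]) :
    Normc.normc u < Normc.normc v -> v - u != 0 /\ v + u != 0.
  move=> lt_uv; rewrite subr_eq0 addr_eq0.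
  by split; apply: contraTneq lt_uv => ->; rewrite ?normcN ltxx.
have [|dM1 dM2] := sub_neq0_of_lt M (P * d).
  apply: lt_le_trans lt_MP _; rewrite Normc.normcM ler_peMr ?(ltW normd) //.
  by rewrite -ler0c -normc_normr normr_ge0.
have [|l1 l2] := sub_neq0_of_lt 1 l; first by rewrite Normc.normc1.
split; [| |exact: normc_ratio_lt|exact: normc_ratio_lt].
  by rewrite !(mulf_neq0, invr_neq0).
by rewrite oppr_eq0 !(mulf_neq0, invr_neq0).
Qed.

(** * Independence of the wave number *)

Lemma sqrtc_gt0 (R : rcfType) (c d : R) : 0 < d ->
  0 < complex.Re (sqrtc (c +i* d)) /\ 0 < complex.Im (sqrtc (c +i* d)).
Proof.
move=> d0 /=; rewrite gt_eqF // gtr0_sg // mul1r !sqrtr_gt0.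
have : `|c| < Num.sqrt (c ^+ 2 + d ^+ 2).
  have d2 : 0 < d ^+ 2 by rewrite exprn_gt0.
  by rewrite -sqrtr_sqr ltr_sqrt ?ltrDl // ltr_wpDl ?sqr_ge0.
rewrite ltr_norml => /andP[lt_nc lt_c].
by rewrite !divr_gt0 //; lra.
Qed.

(** Squaring the principal root loses only a sign, and a positive real part
    fixes it. *)
Lemma zeta_scaling (R : realType) (sigma0 : R) : 0 < sigma0 ->
  exists x y : R, [/\ 0 < x, 0 < y, y ^+ 2 = x ^+ 2 + 1 &
    forall k, 0 < k -> zeta k (sigma0 * k) = k%:C * (x +i* y)].
Proof.
move=> s0; pose w : R[i] := (- 1) +i* sigma0.
have [] := sqrtc_gt0 (- 1) s0; have := sqr_sqrtc w; rewrite -/w.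
case: (sqrtc w) => x y /= sqr_xy x0 y0; exists x, y; split=> // [|k k0].
  by move: sqr_xy; rewrite expr2; simpc => -[re _]; lra.
rewrite /zeta.
have -> : 'i%C * (k * (sigma0 * k))%:C - (k ^+ 2)%:C =
  (- k ^+ 2) +i* (sigma0 * k ^+ 2).
  by simpc; congr (_ +i* _); ring.
have [|] := @sqrtc_gt0 _ (- k ^+ 2) (sigma0 * k ^+ 2);
  first by rewrite mulr_gt0 ?exprn_gt0.
have := sqr_sqrtc ((- k ^+ 2) +i* (sigma0 * k ^+ 2)).
set z := sqrtc _ => sqr_z re_z im_z.
have : (z - k%:C * (x +i* y)) * (z + k%:C * (x +i* y)) == 0.
  rewrite -subr_sqr subr_eq0 sqr_z exprMn sqr_xy /w -rmorphXn; simpc.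
  by rewrite eq_complex /= mulrC !eqxx.
rewrite mulf_eq0 subr_eq0 => /orP[/eqP //|].
rewrite addr_eq0 => /eqP z_eq; move: re_z; rewrite z_eq; simpc.
by rewrite /= oppr_gt0 ltNge ltW // mulr_gt0.
Qed.

(** The exponents contain z only through z L and z delta; the other factors are
    homogeneous of degree 2 in (z, alpha), above and below. *)
Lemma schwarz_scaling (R : realType) (z alpha : R[i]) (k L delta : R) : k != 0 ->
  (schwarz_a (k%:C * z) (k%:C * alpha) (L * k^-1) (delta * k^-1) =
    schwarz_a z alpha L delta) *
  (schwarz_b (k%:C * z) (k%:C * alpha) (L * k^-1) (delta * k^-1) =
    schwarz_b z alpha L delta).
Proof.
move=> k0; have kC0 : k%:C != 0 :> R[i].
  by rewrite -(rmorph0 (real_complex R)) (inj_eq (@complexI _)).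
rewrite /schwarz_a /schwarz_b /schwarz_den.
have phase (c : R[i]) (t : R) : c * (k%:C * z) * (t * k^-1)%:C = c * z * t%:C.
  by rewrite rmorphM fmorphV /=; field.
have phase1 (t : R) : (k%:C * z) * (t * k^-1)%:C = z * t%:C.
  by rewrite -[k%:C * z]mul1r phase mul1r.
have phaseN (t : R) : - (k%:C * z) * (t * k^-1)%:C = - z * t%:C.
  by rewrite !mulNr phase1.
have -> : 2 * (delta * k^-1) + L * k^-1 = (2 * delta + L) * k^-1 by ring.
rewrite !phase !phase1 !phaseN.
have cancel (u v : R[i]) : u / v = (k%:C ^+ 2 * u) / (k%:C ^+ 2 * v).
  by rewrite -mulf_div divff ?mul1r // expf_neq0.
by split; [|congr (- _)]; rewrite [RHS]cancel; congr (_ / _); ring.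
Qed.

Theorem corollary3p4 (R : realType) (sigma0 L0 delta0 : R)
    (hsigma0 : 0 < sigma0) (hL0 : 0 < L0) (hdelta0 : 0 < delta0) :
  let rho := fun (k : R) (N : nat) =>
    rho_T1d k (sigma0 * k) ('i%C * k%:C) (L0 * k^-1) (delta0 * k^-1) N in
  let Rlim := fun k : R =>
    R1d k (sigma0 * k) ('i%C * k%:C) (L0 * k^-1) (delta0 * k^-1) in
  [/\ forall (N : nat) (k k' : R), (1 <= N)%N -> 0 < k -> 0 < k' ->
        rho k N = rho k' N,
      forall k : R, 0 < k -> rho k N @[N --> \oo] --> Rlim k,
      forall k k' : R, 0 < k -> 0 < k' -> Rlim k = Rlim k'
    & forall k : R, 0 < k -> Rlim k < 1].
Proof.
move=> rho Rlim.
have [x [y [x0 y0 yx zetaE]]] := zeta_scaling hsigma0.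
have := schwarz_coefficients x0 y0 yx hL0 hdelta0.
set a := schwarz_a _ _ _ _; set b := schwarz_b _ _ _ _.
move=> [a_neq0 b_neq0 lt_p lt_m].
pose r := Num.max (Normc.normc (a + b)) (Normc.normc (a - b)).
have rhoE k : 0 < k -> rho k =
    fun N => spectral_radius (\mxblock_(i < N.-1, j < N.-1) toeplitz_block a b i j).
  move=> k0; apply/funext => N; rewrite /rho /rho_T1d /T1d.
  rewrite (zetaE k k0).
  rewrite (mulrC 'i%C k%:C).
  have k_neq0 : k != 0 by rewrite gt_eqF.
  by rewrite !(schwarz_scaling (x +i* y) 'i%C L0 delta0 k_neq0).
have cvg_rho k : 0 < k -> rho k N @[N --> \oo] --> r.
  move=> k0; rewrite rhoE //; apply/cvgrPdist_le => e e0.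
  have [m near_m] := toeplitz_spectral_radius_bounds a_neq0 b_neq0 e0.
  exists m.+1 => // N /= lt_mN.
  have /near_m/andP[ge_r le_r] : (m <= N.-1)%N.
    by rewrite -ltnS (ltn_predK lt_mN).
  by rewrite ger0_norm ?subr_ge0 // lerBlDr -lerBlDl.
have RlimE k : 0 < k -> Rlim k = r.
  move=> k0; apply/cvg_lim => //; exact: cvg_rho.
split=> [N k k' _ k0 k0'|k k0|k k' k0 k0'|k k0].
- by rewrite !rhoE.
- by rewrite RlimE //; exact: cvg_rho.
- by rewrite !RlimE.
- by rewrite RlimE // gt_max lt_p.
Qed.
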